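(* Let $f=(f_1,\dots,f_m)\colon\mathbb{R}^n\to\mathbb{R}^m$ and $g\colon\mathbb{R}^n\to Y$ be continuously Fréchet differentiable on $\mathbb{R}^n$, where $Y$ is a Banach space, let $\Theta\subset Y$ be a closed convex cone, and let $\mathcal{F}=\{x\in\mathbb{R}^n : g(x)\in-\Theta\}$. If $\bar x\in\mathcal{F}$ satisfies the BAKKT condition, then $\bar x$ satisfies the KKT condition. (That is, the BAKKT condition is a strict constraint qualification.)
   Context: $\mathbb{R}^m_+$ is the nonnegative orthant of $\mathbb{R}^m$; $m,n\ge 1$; $\mathbb{R}^n$ has the Euclidean norm and usual scalar product (identified with its dual). $Y^*$ is the dual of $Y$, $\langle\cdot,\cdot\rangle$ is the canonical pairing, and $\Theta_+:=\{\mu\in Y^* : \langle\mu,\theta\rangle\ge 0\ \ \forall\theta\in\Theta\}$. $\nabla f_i(x)$ is the gradient of $f_i$, $\nabla g(x)\colon\mathbb{R}^n\to Y$ is the derivative of $g$ at $x$, and $\nabla g(x)^*\colon Y^*\to\mathbb{R}^n$ is its adjoint. A point $\bar x\in\mathcal{F}$ satisfies the KKT condition if there exists $(\lambda,\mu)\in\mathbb{R}^m_+\times\Theta_+$ such that $\sum_{i=1}^m\lambda_i=1$, $\nabla g(\bar x)^*\mu+\sum_{i=1}^m\lambda_i\nabla f_i(\bar x)=0$, and $\langle\mu,g(\bar x)\rangle=0$. A point $\bar x\in\mathcal{F}$ satisfies the AKKT (approximate Karush--Kuhn--Tucker) condition if there exist $\lambda\in\mathbb{R}^m_+$ with $\sum_{i=1}^m\lambda_i=1$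 and sequences $\{x^k\}\subset\mathbb{R}^n$ (not required to be feasible) and $\{\mu^k\}\subset\Theta_+$ such that, as $k\to\infty$: $x^k\to\bar x$; $\nabla g(x^k)^*\mu^k+\sum_{i=1}^m\lambda_i\nabla f_i(\bar x)\to 0$; and $\langle\mu^k,g(x^k)\rangle\to 0$. A point $\bar x\in\mathcal{F}$ satisfies the BAKKT (bounded AKKT) condition if such $\lambda$, $\{x^k\}$, $\{\mu^k\}$ exist with, in addition, $\{\mu^k\}$ bounded in the norm of $Y^*$. A property P is a strict constraint qualification if, at a feasible point, AKKT together with P implies KKT. *)

(* Defs.v *)
From HB Require Import structures.
From mathcomp Require Export all_boot all_order all_algebra.
From mathcomp Require Export all_classical all_reals all_analysis.

Set Implicit Arguments.
Unset Strict Implicit.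
Unset Printing Implicit Defensive.

Export Order.TTheory GRing.Theory Num.Theory.
Export numFieldNormedType.Exports.

Local Open Scope classical_set_scope.
Local Open Scope ring_scope.

(* For a linear map [A] which is not continuous, [sup] takes the default value
   [0]; below, [opnorm] is applied to continuous linear maps only. *)
Definition opnorm (R : realType) (V W : normedModType R) (A : V -> W) : R :=
  sup [set `|A v| | v in [set v : V | `|v| <= 1]].

Definition continuously_differentiable (R : realType) (V W : normedModType R)
    (h : V -> W) : Prop :=
  (forall x : V, differentiable h x) /\
  (forall x : V, opnorm (fun v => 'd h y v - 'd h x v) @[y --> x] --> (0 : R)).

Definition topological_dual (R : realType) (Y : normedModType R) :
    set {linear Y -> R^o} :=
  [set mu | continuous mu].

Definition cone (R : realType) (Y : lmodType R) (T : set Y) : Prop :=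
  forall (t : R) (y : Y), 0 <= t -> T y -> T (t *: y).

Definition dual_cone (R : realType) (Y : normedModType R) (T : set Y) :
    set {linear Y -> R^o} :=
  [set mu | topological_dual mu /\ forall y : Y, T y -> 0 <= mu y].

(* R^n is ['rV[R]_n].  The norm that the library puts on it is the maximum norm,
   which is equivalent to the Euclidean one and hence gives the same limits,
   derivatives and continuously differentiable maps.  The scalar product enters
   through [riesz l], the vector [w] such that [l v] is the scalar product of
   [w] and [v] for all [v] (if [l] is linear). *)
Definition riesz (R : realType) (n : nat) (l : 'rV[R]_n -> R) : 'rV[R]_n :=
  \row_(j < n) l (delta_mx 0 j).

Definition gradient (R : realType) (n : nat) (h : 'rV[R]_n -> R^o)
    (x : 'rV[R]_n) : 'rV[R]_n :=
  riesz ('d h x).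

Definition adjoint (R : realType) (n : nat) (Y : normedModType R)
    (A : 'rV[R]_n -> Y) (mu : Y -> R) : 'rV[R]_n :=
  riesz (mu \o A).

Definition component (R : realType) (n m : nat) (f : 'rV[R]_n -> 'rV[R]_m)
    (i : 'I_m) : 'rV[R]_n -> R^o :=
  fun x => f x 0 i.

Definition feasible (R : realType) (n : nat) (Y : normedModType R)
    (g : 'rV[R]_n -> Y) (T : set Y) : set 'rV[R]_n :=
  [set x | [set - y | y in T] (g x)].

Definition multiplier (R : realType) (m : nat) (lambda : 'rV[R]_m) : Prop :=
  (forall i, 0 <= lambda 0 i) /\ \sum_(i < m) lambda 0 i = 1.

Definition KKT (R : realType) (n m : nat) (Y : normedModType R)
    (f : 'rV[R]_n -> 'rV[R]_m) (g : 'rV[R]_n -> Y) (T : set Y)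
    (xbar : 'rV[R]_n) : Prop :=
  exists (lambda : 'rV[R]_m) (mu : {linear Y -> R^o}),
    [/\ multiplier lambda,
        dual_cone T mu,
        adjoint ('d g xbar) mu
          + \sum_(i < m) lambda 0 i *: gradient (component f i) xbar = 0
      & mu (g xbar) = 0].

Definition AKKT_sequence (R : realType) (n m : nat) (Y : normedModType R)
    (f : 'rV[R]_n -> 'rV[R]_m) (g : 'rV[R]_n -> Y) (T : set Y)
    (xbar : 'rV[R]_n) (lambda : 'rV[R]_m) (x : nat -> 'rV[R]_n)
    (mu : nat -> {linear Y -> R^o}) : Prop :=
  multiplier lambda /\
  [/\ forall k, dual_cone T (mu k),
      x k @[k --> \oo] --> xbar,
      (adjoint ('d g (x k)) (mu k)
         + \sum_(i < m) lambda 0 i *: gradient (component f i) xbar)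
        @[k --> \oo] --> (0 : 'rV[R]_n)
    & mu k (g (x k)) @[k --> \oo] --> (0 : R)].

Definition AKKT (R : realType) (n m : nat) (Y : normedModType R)
    (f : 'rV[R]_n -> 'rV[R]_m) (g : 'rV[R]_n -> Y) (T : set Y)
    (xbar : 'rV[R]_n) : Prop :=
  exists lambda x mu, @AKKT_sequence R n m Y f g T xbar lambda x mu.

Definition BAKKT (R : realType) (n m : nat) (Y : normedModType R)
    (f : 'rV[R]_n -> 'rV[R]_m) (g : 'rV[R]_n -> Y) (T : set Y)
    (xbar : 'rV[R]_n) : Prop :=
  exists lambda x mu,
    @AKKT_sequence R n m Y f g T xbar lambda x mu /\
    exists M : R, forall k, opnorm (mu k) <= M.

Definition strict_constraint_qualification (R : realType) (n m : nat)
    (Y : normedModType R) (f : 'rV[R]_n -> 'rV[R]_m) (g : 'rV[R]_n -> Y)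
    (T : set Y) (P : 'rV[R]_n -> Prop) : Prop :=
  forall xbar, feasible g T xbar ->
    AKKT f g T xbar -> P xbar -> KKT f g T xbar.

(* Main.v *)
From HB Require Import structures.
Require Import Defs.
From mathcomp Require Import all_boot all_order all_algebra.
From mathcomp Require Import all_classical all_reals all_analysis.
Import numFieldNormedType.Exports.

Set Implicit Arguments.
Unset Strict Implicit.

Local Open Scope classical_set_scope.
Local Open Scope ring_scope.

(** Along an ultrafilter finer than [\oo], a norm-bounded sequence of functionals
    converges pointwise to a bounded linear functional, because its values at
    each point stay in a compact interval.  This gives a weak-* limit [mu] of the
    whole sequence [mu_k] along one filter, although the dual ball need not be
    weak-* sequentially compact.  Nonnegativity on [Theta] passes to the limit,
    and since [mu_k] is bounded, [mu_k z_k] and [mu_k z] have the same limit when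
    [z_k --> z]; with [z_k = g x_k] and [z_k = 'd g x_k e_j] the AKKT relations
    become the KKT relations for [mu]. *)

Lemma ultra_fmap (T U : Type) (f : T -> U) (F : set_system T) :
  UltraFilter F -> UltraFilter (f @ F).
Proof.
move=> FU; split=> [|G GF FG]; first exact: fmap_proper_filter.
rewrite predeqE => A; split; last exact: FG.
(* Otherwise the preimage of the complement of [A] lies in [F], so [G] would contain both [A] and
   its complement. *)
move=> GA; case: (in_ultra_setVsetC (f @^-1` A) FU) => // FnA.
have GnA : G (~` A) by exact: FG.
by case: (filter_ex (filterI GA GnA)) => x [].
Qed.

Lemma ultra_bounded_cvg (R : realType) (T : Type) (F : set_system T)
    (f : T -> R) (b : R) :
  UltraFilter F -> (forall t, `|f t| <= b) -> exists l : R, f @ F --> l.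
Proof.
move=> FU fb; have := @segment_compact R (- b) b; rewrite compact_ultra.
move=> /(_ _ (ultra_fmap f FU)) [|l [_ fl]]; last by exists l.
have FF : ProperFilter F by exact: ultra_proper.
by apply: (filterE (F := F)) => t /=; rewrite in_itv /= -ler_norml.
Qed.

(** Continuity bounds [A] on the unit ball, so the supremum is a genuine one; rescaling [v] to norm
    one gives the estimate. *)
Lemma ler_opnorm (R : realType) (V W : normedModType R) (A : {linear V -> W})
    (v : V) :
  continuous A -> `|A v| <= opnorm A * `|v|.
Proof.
move=> cA.
have /linear_boundedP/pinfty_ex_gt0[C C0 AC] : bounded_near A (nbhs 0).
  by apply: continuous_linear_bounded; exact: cA.
have [->|v0] := eqVneq v 0; first by rewrite linear0 !normr0 mulr0.
have nv0 : 0 < `|v| by rewrite normr_gt0.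
rewrite -ler_pdivrMr// mulrC.
have -> : `|v|^-1 * `|A v| = `|A (`|v|^-1 *: v)|.
  by rewrite linearZ normrZ gtr0_norm// invr_gt0.
apply: ub_le_sup.
  exists C => _ [w /= w1 <-]; apply: le_trans (AC w) _.
  by rewrite -[leRHS]mulr1 ler_wpM2l// ltW.
exists (`|v|^-1 *: v) => //=.
by rewrite normrZ gtr0_norm ?invr_gt0// mulVf// gt_eqF.
Qed.

(** For fixed [v], the two values differ by at most the operator norm of the difference of the
    derivatives times the norm of [v]. *)
Lemma diff_cvg (R : realType) (V W : normedModType R) (h : V -> W) (x v : V) :
  continuously_differentiable h -> 'd h y v @[y --> x] --> 'd h x v.
Proof.
move=> [dh ch]; apply: cvg_zero; apply/norm_cvg0P.
apply: (@squeeze_cvgr _ _ _ _ (fun=> 0)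
  (fun y => opnorm (fun w => 'd h y w - 'd h x w) * `|v|)).
- apply: filterE => y; rewrite normr_ge0 /=.
  apply: (@ler_opnorm _ _ _ ('d h y \- 'd h x : {linear V -> W}) v) => z.
  by apply: cvgB; apply: diff_continuous; apply: dh.
- exact: cvg_cst.
- by rewrite -[X in _ --> X](mul0r `|v|); apply: cvgMl; exact: ch.
Qed.

(** Split [mu t (z t)] as [mu t (z t - y) + mu t y]; the uniform bound sends the first term to
    [0]. *)
Lemma cvg_bounded_pairing (R : realType) (Y : normedModType R) (T : Type)
    (F : set_system T) (mu : T -> {linear Y -> R^o}) (M : R) (z : T -> Y)
    (y : Y) (l : R) :
  Filter F -> (forall t v, `|mu t v| <= M * `|v|) -> z @ F --> y ->
  (mu t y : R) @[t --> F] --> l -> (mu t (z t) : R) @[t --> F] --> l.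
Proof.
move=> FF muM zy muy.
have mu0 : (mu t (z t - y) : R) @[t --> F] --> (0 : R).
  apply/norm_cvg0P.
  apply: (@squeeze_cvgr _ _ _ _ (fun=> 0) (fun t => M * `|z t - y|)).
  - by apply: filterE => t; rewrite normr_ge0 muM.
  - exact: cvg_cst.
  - rewrite -[X in _ --> X](mulr0 M) -(@normr0 _ Y) -(subrr y).
    by apply: cvgMr; apply: cvg_norm; apply: cvgB => //; exact: cvg_cst.
rewrite -[l]add0r.
under eq_fun do rewrite -[z _](subrK y) linearD.
exact: cvgD.
Qed.

Lemma bounded_ultra_weak_limit (R : realType) (Y : normedModType R) (T : Type)
    (F : set_system T) (mu : T -> {linear Y -> R^o}) (M : R) :
  UltraFilter F -> (forall t v, `|mu t v| <= M * `|v|) ->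
  exists nu : {linear Y -> R^o},
    continuous nu /\ forall y, (mu t y : R) @[t --> F] --> (nu y : R).
Proof.
move=> FU muM.
have FF : ProperFilter F by exact: ultra_proper.
have /choice[nu nuE] y : exists l : R, (mu t y : R) @[t --> F] --> l.
  exact: (@ultra_bounded_cvg _ _ _ _ (M * `|y|)).
(* Linearity comes from uniqueness of limits: both sides are limits of [mu t (a *: u + v)]. *)
have nu_lin : linear (nu : Y -> R^o).
  move=> a u v.
  have muD : (mu t (a *: u + v) : R) @[t --> F] --> a * nu u + nu v.
    under eq_fun do rewrite linearP.
    by apply: cvgD; [apply: cvgMr|].
  exact: cvg_unique (nuE _) muD.
pose nuL : {linear Y -> R^o} :=
  HB.pack (nu : Y -> R^o) (GRing.isLinear.Build R Y R^o _ nu nu_lin).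
exists nuL; split => //; apply/linear_bounded_continuous/linear_boundedP.
(* The uniform bound survives in the limit, and a linear functional bounded this way is
   continuous. *)
have nuM y : `|nu y| <= M * `|y|.
  by apply: (cvgr_to_le (cvg_norm (nuE y))); apply: filterE => t; exact: muM.
by near=> r => y; apply: le_trans (nuM y) _; rewrite ler_wpM2r.
Unshelve. all: by end_near. Qed.

Lemma BAKKT_KKT (R : realType) (n m : nat) (Y : normedModType R)
    (f : 'rV[R]_n -> 'rV[R]_m) (g : 'rV[R]_n -> Y) (T : set Y)
    (xbar : 'rV[R]_n) :
  continuously_differentiable g -> BAKKT f g T xbar -> KKT f g T xbar.
Proof.
move=> hg [lambda [x [mu [[hl [hmu hx hadj hcomp]] [M hM]]]]].
have [U [UU ooU]] := ultraFilterLemma (F := \oo : set_system nat) _.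
have UF : ProperFilter U by exact: ultra_proper.
(* [U] refines [\oo], so each limit in the AKKT condition persists along [U]. *)
have cvgU (V : topologicalType) (u : nat -> V) (l : V) :
    u @ \oo --> l -> u @ U --> l.
  by move=> ul A /ul; exact: ooU.
have muM k v : `|mu k v| <= M * `|v|.
  have [muc _] := hmu k.
  by apply: le_trans (ler_opnorm v muc) _; rewrite ler_wpM2r.
have [nu [nu_cont nuE]] := bounded_ultra_weak_limit UU muM.
have nu_cvg (z : nat -> Y) (y : Y) :
    z @ U --> y -> (mu k (z k) : R) @[k --> U] --> (nu y : R).
  by move=> zy; exact: cvg_bounded_pairing muM zy (nuE y).
(* [lambda] does not vary with [k], so it is kept unchanged. *)
exists lambda, nu; split => //.
- split=> // y Ty; apply: (cvgr_to_ge (nuE y)).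
  by apply: filterE => k; have [_] := hmu k; exact.
- apply/rowP => j; rewrite mxE [RHS]mxE.
  (* Coordinate [j] of the AKKT residual tends to [0] along [U]; its limit is computed again through
     [nu], and the two limits agree. *)
  have lim0 := cvg_comp _ _ (cvgU _ _ _ hadj) (@coord_continuous _ _ _ 0 j _).
  rewrite mxE in lim0; apply: cvg_unique lim0 => //; rewrite /comp /=.
  have -> : (fun k => (adjoint ('d g (x k)) (mu k)
      + \sum_(i < m) lambda 0 i *: gradient (component f i) xbar) 0 j) =
    (fun k => (mu k ('d g (x k) (delta_mx 0 j)) : R)
      + (\sum_(i < m) lambda 0 i *: gradient (component f i) xbar) 0 j).
    by apply/funext => k; rewrite !mxE.
  apply: cvgD; last exact: cvg_cst.
  rewrite mxE; apply: nu_cvg.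
  exact: (cvg_comp _ _ (cvgU _ _ _ hx) (@diff_cvg _ _ _ _ _ (delta_mx 0 j) hg)).
(* Since [g] is continuous at [xbar], the values [mu k (g (x k))] tend to [nu (g xbar)] as well as
   to [0]. *)
- have nu_g : (mu k (g (x k)) : R) @[k --> U] --> (nu (g xbar) : R).
    apply: nu_cvg; apply: (cvg_comp _ _ (cvgU _ _ _ hx)).
    exact: differentiable_continuous (hg.1 xbar).
  exact: cvg_unique nu_g (cvgU _ _ _ hcomp).
Qed.

Unset Implicit Arguments.
Set Strict Implicit.

Theorem theorem3p7 (R : realType) (n m : nat) (hn : (0 < n)%N) (hm : (0 < m)%N)
    (Y : completeNormedModType R)
    (f : 'rV[R]_n -> 'rV[R]_m) (g : 'rV[R]_n -> Y) (Theta : set Y)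
    (hf : continuously_differentiable f)
    (hg : continuously_differentiable g)
    (hclosed : closed Theta) (hconvex : convex_set Theta) (hcone : cone Theta) :
  (forall xbar : 'rV[R]_n, feasible g Theta xbar ->
     BAKKT f g Theta xbar -> KKT f g Theta xbar) /\
  strict_constraint_qualification f g Theta (BAKKT f g Theta).
Proof.
by split=> [xbar _|xbar _ _]; exact: BAKKT_KKT.
Qed.
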